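(* Let $F/\mathbb{F}_q$ be an algebraic function field of genus $g(F)$ and let $m\ge 1$ be an integer. Let $R^*$ denote the optimal recovery threshold of Matdot AG codes over $F/\mathbb{F}_q$ with parameter $m$, i.e. the minimum of the recovery thresholds $R=\deg((h)_\infty)+1$, $h=fg$, over all Matdot AG codes $(f_1,\dots,f_m;\,g_1,\dots,g_m)$ over $F/\mathbb{F}_q$. If $m\ge g(F)+1$, then $$R^*\ \ge\ 2g(F)+2m-1.$$
   Context: Here $q$ is a prime power and $F/\mathbb{F}_q$ is an algebraic function field of one variable with full constant field $\mathbb{F}_q$; $v_P$ is the normalized discrete valuation at a place $P$, and $(z)_\infty$ is the pole divisor of $z$. Matdot AG code: matrices $A\in\mathbb{F}_q^{r\times s}$, $B\in\mathbb{F}_q^{s\times t}$ with $m\mid s$ are partitioned into column blocks $A_1,\dots,A_m$ of $A$ and row blocks $B_1,\dots,B_m$ of $B$, so that $AB=\sum_{i=1}^mA_iB_i$. One chooses nonzero functions $f_1,\dots,f_m,g_1,\dots,g_m\in F$ such that, for some place $Q$ of $F$ and some integer $d$, among the $m^2$ products $f_ig_j$ exactly the $m$ products $f_ig_i$ have valuation $d$ at $Q$; that is, $v_Q(f_ig_j)=d$ if and only if $i=j$. Put $f=\sum_iA_if_i$, $g=\sum_jB_jg_j$, $h=fg=\sum_{i,j}A_iB_jf_ig_j$. The pole divisor $(h)_\infty$ is understood as that of the code, independently of the particular $A,B$: it is the least common multiple (place-wise maximum) of the pole divisors $(f_ig_j)_\infty$, $1\le i,j\le m$. The recovery threshold of the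 code is $R=\deg((h)_\infty)+1$. *)

(* Defs.v *)
From HB Require Import structures.
From mathcomp Require Import all_boot all_order all_algebra.
From mathcomp Require Import boolp classical_sets cardinality fsbigop.

Set Implicit Arguments.
Unset Strict Implicit.
Unset Printing Implicit Defensive.

Import Order.TTheory GRing.Theory Num.Theory.
Local Open Scope classical_set_scope.
Local Open Scope ring_scope.

Section FunctionField.
Variables (K : finFieldType) (F : fieldType) (iota : {rmorphism K -> F}).

(* The field K(x) inside F. *)
Definition simple_ext (x : F) : set F :=
  [set z | exists p q : {poly K}, (map_poly iota q).[x] != 0 /\
             z = (map_poly iota p).[x] / (map_poly iota q).[x]].

Definition function_field : Prop :=
  exists x : F, ~ algebraicOver iota x /\
    exists (n : nat) (b : 'I_n -> F), forall z : F,
      exists c : 'I_n -> F,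
        (forall i, simple_ext x (c i)) /\ z = \sum_(i < n) c i * b i.

Definition full_constant_field : Prop :=
  forall z : F, algebraicOver iota z -> exists a : K, z = iota a.

(* A place is identified with its normalized discrete valuation. The value
   at 0 (mathematically +oo) is fixed to be 0, so that the valuation on
   nonzero elements determines the place; it carries no meaning, and every
   use below is restricted to nonzero elements. *)
Record place := Place {
  valuation :> F -> int;
  valuation0 : valuation 0 = 0;
  valuationM : forall x y, x != 0 -> y != 0 ->
    valuation (x * y) = valuation x + valuation y;
  valuationD : forall x y, x != 0 -> y != 0 -> x + y != 0 ->
    Num.min (valuation x) (valuation y) <= valuation (x + y);
  valuation_const : forall a : K, a != 0 -> valuation (iota a) = 0;
  valuation_normalized : exists2 t, t != 0 & valuation t = 1 }.

HB.instance Definition _ := gen_eqMixin place.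
HB.instance Definition _ := gen_choiceMixin place.

(* b is a K-basis of V modulo W, for K-subspaces W of V in F. *)
Definition basis_mod (V W : set F) (n : nat) (b : 'I_n -> F) : Prop :=
  [/\ forall i, V (b i),
      forall a : 'I_n -> K, W (\sum_(i < n) iota (a i) * b i) ->
        forall i, a i = 0
    & forall z, V z -> exists a : 'I_n -> K,
        W (z - \sum_(i < n) iota (a i) * b i)].

(* dim_K (V / W) when this is finite, which it is in the two uses below. *)
Definition dim_mod (V W : set F) : nat :=
  xget 0%N [set n | exists b : 'I_n -> F, basis_mod V W b].

Definition valuation_ring (P : place) : set F :=
  [set z | z != 0 -> 0 <= P z].

Definition maximal_ideal (P : place) : set F :=
  [set z | z != 0 -> 0 < P z].

Definition place_degree (P : place) : nat :=
  dim_mod (valuation_ring P) (maximal_ideal P).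

Definition divisor (D : place -> int) : Prop := finite_set [set P | D P != 0].

Definition divisor_degree (D : place -> int) : int :=
  \sum_(P \in [set: place]) D P * (place_degree P)%:Z.

Definition riemann_roch_space (D : place -> int) : set F :=
  [set z | z != 0 -> forall P : place, - D P <= P z].

Definition ell (D : place -> int) : nat :=
  dim_mod (riemann_roch_space D) [set 0].

(* g is the maximum of deg D - ell D + 1 over all divisors D. *)
Definition is_genus (g : nat) : Prop :=
  (exists2 D, divisor D & divisor_degree D - (ell D)%:Z + 1 = g%:Z) /\
  (forall D, divisor D -> divisor_degree D - (ell D)%:Z + 1 <= g%:Z).

Definition pole_divisor (z : F) : place -> int :=
  fun P => Num.max 0 (- P z).

Record matdot_code (m : nat) := MatdotCode {
  code_f : 'I_m -> F;
  code_g : 'I_m -> F;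
  code_f_neq0 : forall i, code_f i != 0;
  code_g_neq0 : forall j, code_g j != 0;
  code_valuation : exists (Q : place) (d : int), forall i j : 'I_m,
    Q (code_f i * code_g j) = d <-> i = j }.

(* The pole divisor of h = (\sum_i A_i f_i) (\sum_j B_j g_j), taken uniformly
   in the matrix blocks: the lcm of the pole divisors of the f_i g_j. *)
Definition code_pole_divisor m (c : matdot_code m) : place -> int :=
  fun P => \big[Num.max/0]_(i < m) \big[Num.max/0]_(j < m)
             pole_divisor (code_f c i * code_g c j) P.

Definition recovery_threshold m (c : matdot_code m) : int :=
  divisor_degree (code_pole_divisor c) + 1.

Definition is_optimal_threshold (m : nat) (R : int) : Prop :=
  (exists c : matdot_code m, recovery_threshold c = R) /\
  (forall c : matdot_code m, R <= recovery_threshold c).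

End FunctionField.

(* Main.v *)
(* Write [L(D)] for the Riemann-Roch space of [D] and [i(D) = ell D - deg D + g - 1]
   for its index of specialty.  Since [v_Q (f_i g_j) = d] iff [i = j], the [f_i]
   have pairwise distinct valuations at [Q], so they are linearly independent
   elements of [L(D_f)], where [D_f] is the place-wise maximum of the [- v_P f_i];
   likewise for the [g_j].  The pole divisor of the code dominates [D_f + D_g],
   so it is enough that [ell D >= g + 1] implies [i(D) <= 0].  For this only the
   adelic half of Riemann-Roch is needed: if [A] is the space of adeles, then
   [A / (A(0) + F)] has dimension at most [g], while [i(D) > 0] makes
   [A(D) + F] a proper subspace of [A].  A nonzero functional on [A] killing
   [A(D) + F], multiplied by the elements of [L(D)], embeds [L(D)] in the dual
   of [A / (A(0) + F)], so that [ell D <= g]. *)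

Require Import Defs.
From mathcomp Require Import all_boot all_order all_algebra.
From HB Require Import structures.
From mathcomp Require Import zify ring.
From mathcomp Require Import boolp classical_sets functions cardinality fsbigop.

Set Implicit Arguments.
Unset Strict Implicit.
Unset Printing Implicit Defensive.

Import Order.TTheory GRing.Theory Num.Theory.
Local Open Scope classical_set_scope.
Local Open Scope ring_scope.

(** * Linear algebra modulo a subspace *)

Section DimensionModulo.
Variable K : fieldType.
Implicit Types V : lmodType K.

Definition subspace V (W : set V) : Prop :=
  W 0 /\ forall (a : K) u v, W u -> W v -> W (a *: u + v).

Definition indep_mod V (W : set V) n (b : 'I_n -> V) : Prop :=
  forall a : 'I_n -> K, W (\sum_(i < n) a i *: b i) -> forall i, a i = 0.

Definition span_mod V (W U : set V) n (b : 'I_n -> V) : Prop :=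
  forall z, U z -> exists a : 'I_n -> K, W (z - \sum_(i < n) a i *: b i).

(** Restates [basis_mod] over an arbitrary [lmodType], so that the same lemmas serve quotients of
    [F] and quotients of spaces of adeles. *)
Definition has_dim V (W U : set V) n : Prop :=
  exists b : 'I_n -> V,
    [/\ forall i, U (b i), indep_mod W b & span_mod W U b].

Lemma subspaceD V (W : set V) u v : subspace W -> W u -> W v -> W (u + v).
Proof. by move=> [_ H] Wu Wv; rewrite -[u]scale1r; apply: H. Qed.

Lemma subspaceZ V (W : set V) a u : subspace W -> W u -> W (a *: u).
Proof. by move=> [W0 H] Wu; rewrite -[_ *: u]addr0; apply: H. Qed.

Lemma subspaceN V (W : set V) u : subspace W -> W u -> W (- u).
Proof. by move=> sW Wu; rewrite -scaleN1r; apply: subspaceZ. Qed.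

Lemma subspaceB V (W : set V) u v : subspace W -> W u -> W v -> W (u - v).
Proof. by move=> sW Wu Wv; apply: subspaceD => //; apply: subspaceN. Qed.

Lemma subspace_sum V (W : set V) n (a : 'I_n -> K) (b : 'I_n -> V) :
  subspace W -> (forall i, W (b i)) -> W (\sum_(i < n) a i *: b i).
Proof.
move=> sW Wb; apply: big_ind => [|u v|i _]; first by case: sW.
  exact: subspaceD.
exact: subspaceZ.
Qed.

Lemma wide_matrix_kernel m n (A : 'M[K]_(m, n)) : (n < m)%N ->
  exists2 v : 'rV_m, v != 0 & v *m A = 0.
Proof.
move=> ltnm; have /rowV0Pn[v vker v0] : kermx A != 0.
  rewrite -mxrank_eq0 mxrank_ker subn_eq0 -ltnNge.
  exact: leq_ltn_trans (rank_leq_col A) ltnm.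
by exists v => //; apply/sub_kermxP.
Qed.

(** Steinitz bound: the coordinates of the [c i] modulo [W] form an [m] by [n] matrix, and for
    [n < m] a vector of its left kernel would be a nontrivial relation between the [c i] modulo
    [W]. *)
Lemma indep_mod_leq_span V (W U : set V) n (b : 'I_n -> V) m (c : 'I_m -> V) :
  subspace W -> span_mod W U b -> (forall i, U (c i)) -> indep_mod W c ->
  (m <= n)%N.
Proof.
move=> sW spb Uc indc; rewrite leqNgt; apply/negP => /wide_matrix_kernel H.
pose a i := projT1 (cid (spb _ (Uc i))).
have Wa i : W (c i - \sum_(j < n) a i j *: b j).
  by rewrite /a; case: (cid _).
have [v v0 vA0] := H (\matrix_(i, j) a i j).
case/eqP: v0; apply/rowP => i; rewrite mxE; apply: (indc (fun i => v 0 i)).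
have := subspace_sum (fun i => v 0 i) sW Wa.
under eq_bigr do rewrite scalerBr scaler_sumr.
rewrite big_split /= sumrN exchange_big /=.
rewrite [X in _ - X]big1 ?subr0// => j _.
transitivity ((v *m \matrix_(i, j) a i j) 0 j *: b j); last first.
  by rewrite vA0 mxE scale0r.
rewrite mxE scaler_suml; apply: eq_bigr => k _.
by rewrite mxE scalerA.
Qed.

Lemma has_dim_inj V (W U : set V) m n : subspace W ->
  has_dim W U m -> has_dim W U n -> m = n.
Proof.
move=> sW [b [Ub ib sb]] [c [Uc ic sc]]; apply/eqP; rewrite eqn_leq.
by rewrite (indep_mod_leq_span sW sc Ub ib) (indep_mod_leq_span sW sb Uc ic).
Qed.

Definition fcat (T : Type) m n (b : 'I_m -> T) (c : 'I_n -> T) :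
    'I_(m + n) -> T :=
  fun i => match fintype.split i with inl j => b j | inr j => c j end.

Lemma fcat_lshift (T : Type) m n (b : 'I_m -> T) (c : 'I_n -> T) i :
  fcat b c (lshift n i) = b i.
Proof. by rewrite /fcat (unsplitK (inl i)). Qed.

Lemma fcat_rshift (T : Type) m n (b : 'I_m -> T) (c : 'I_n -> T) i :
  fcat b c (rshift m i) = c i.
Proof. by rewrite /fcat (unsplitK (inr i)). Qed.

Lemma fcatP (T : Type) m n (b : 'I_m -> T) (c : 'I_n -> T) (P : T -> Prop) :
  (forall i, P (b i)) -> (forall i, P (c i)) -> forall i, P (fcat b c i).
Proof. by move=> Pb Pc i; rewrite /fcat; case: splitP. Qed.

Lemma sum_fcat V m n (b : 'I_m -> V) (c : 'I_n -> V) (a : 'I_(m + n) -> K) :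
  \sum_(i < m + n) a i *: fcat b c i =
  \sum_(i < m) a (lshift n i) *: b i + \sum_(i < n) a (rshift m i) *: c i.
Proof.
rewrite big_split_ord; congr (_ + _); apply: eq_bigr => i _.
  by rewrite fcat_lshift.
by rewrite fcat_rshift.
Qed.

Lemma indep_mod_fcat V (W W' : set V) m n (b : 'I_m -> V) (c : 'I_n -> V) :
  subspace W' -> W `<=` W' -> (forall i, W' (b i)) ->
  indep_mod W b -> indep_mod W' c -> indep_mod W (fcat b c).
Proof.
move=> sW' WW' W'b ib ic a; rewrite sum_fcat => Wa.
have ac0 : forall i, a (rshift m i) = 0.
  apply: ic; have := subspaceB sW' (WW' _ Wa)
    (subspace_sum (fun i => a (lshift n i)) sW' W'b).
  by rewrite addrAC subrr add0r.
have ab0 : forall i, a (lshift n i) = 0.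
  apply: ib; move: Wa; rewrite [X in _ + X]big1 ?addr0// => i _.
  by rewrite ac0 scale0r.
by move=> i; rewrite -[i](fintype.splitK i); case: (fintype.split i) => j /=.
Qed.

Lemma has_dimD V (W U T : set V) m n : subspace U -> W `<=` U -> U `<=` T ->
  has_dim W U m -> has_dim U T n -> has_dim W T (m + n).
Proof.
move=> sU WU UT [b [Ub ib sb]] [c [Tc ic sc]]; exists (fcat b c); split.
- by apply: fcatP => // i; apply: UT.
- exact: indep_mod_fcat ic.
- move=> z Tz; have [a Ua] := sc z Tz; have [a' Wa'] := sb _ Ua.
  exists (fcat a' a); rewrite sum_fcat opprD [- _ + - _]addrC addrA.
  under eq_bigr do rewrite fcat_rshift.
  by under [X in _ - X]eq_bigr do rewrite fcat_lshift.
Qed.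

(** An independent family of maximal length spans, since a vector outside its span could be appended
    to it. This is how finite dimension is obtained throughout. *)
Lemma has_dim_bounded V (W U : set V) N : subspace W ->
  (forall n (b : 'I_n -> V), (forall i, U (b i)) -> indep_mod W b ->
     (n <= N)%N) ->
  exists2 n, (n <= N)%N & has_dim W U n.
Proof.
move=> sW bnd.
pose P n := `[< exists2 b : 'I_n -> V, forall i, U (b i) & indep_mod W b >].
have P0 : exists n, P n.
  by exists 0%N; apply/asboolP; exists (fun=> 0) => [[]|? ? []].
have PN n : P n -> (n <= N)%N by move=> /asboolP[b Ub ib]; exact: bnd ib.
case: (ex_maxnP P0 PN) => n Pn nmax; exists n; first exact: PN.
move/asboolP: (Pn) => [b Ub ib]; exists b; split=> // z Uz.
apply: contrapT => nsp.
suff /nmax : P (n + 1)%N by rewrite addn1 ltnn.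
apply/asboolP; exists (fcat b (fun _ : 'I_1 => z)); first exact: fcatP.
move=> a; rewrite sum_fcat big_ord1 => Wa.
have az0 : a (rshift n ord0) = 0.
  apply: contrapT => /eqP az; apply: nsp.
  exists (fun i => - (a (lshift 1 i) / a (rshift n ord0))).
  have := subspaceZ (a (rshift n ord0))^-1 sW Wa.
  rewrite scalerDr scalerA mulVf// scale1r addrC scaler_sumr -sumrN.
  congr W; congr (_ + _); apply: eq_bigr => i _.
  by rewrite scaleNr opprK scalerA mulrC.
have ab0 : forall i, a (lshift 1 i) = 0.
  by apply: ib; move: Wa; rewrite az0 scale0r addr0.
by move=> i; rewrite -[i](fintype.splitK i); case: (fintype.split i) => j /=;
  rewrite ?ord1.
Qed.

Lemma has_dim_sub V (W U T : set V) n : subspace W -> U `<=` T ->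
  has_dim W T n -> exists2 m, (m <= n)%N & has_dim W U m.
Proof.
move=> sW UT [b [_ _ sb]]; apply: has_dim_bounded => // k c Uc ic.
by apply: (indep_mod_leq_span sW sb _ ic) => i; apply: UT.
Qed.

Lemma linear_sumZ V V' (phi : V -> V') : linear phi ->
  forall n (a : 'I_n -> K) (b : 'I_n -> V),
  phi (\sum_(i < n) a i *: b i) = \sum_(i < n) a i *: phi (b i).
Proof.
move=> lin n a b; have phi0 : phi 0 = 0.
  by have := lin (-1) 0 0; rewrite scaler0 addr0 scaleN1r addNr.
by apply: (big_rec2 (fun x y => phi x = y)) => // i x y _ <-; rewrite lin.
Qed.

(** The hypotheses say that [phi] induces an isomorphism from [U / W] onto [U' / W']. *)
Lemma has_dim_transport V V' (phi : V -> V') (W U : set V) (W' U' : set V') n :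
  linear phi -> subspace W' ->
  (forall z, U z -> U' (phi z)) -> (forall z, U z -> W' (phi z) -> W z) ->
  (forall z, W z -> W' (phi z)) ->
  (forall a, U' a -> exists2 z, U z & W' (a - phi z)) ->
  subspace U -> has_dim W U n -> has_dim W' U' n.
Proof.
move=> lin sW' UU' WW W'W surj sU [b [Ub ib sb]].
exists (phi \o b); split=> [i|a|a U'a] /=.
- exact: UU'.
- by rewrite -linear_sumZ// => /WW-/(_ (subspace_sum _ sU Ub)); apply: ib.
- have [z Uz W'z] := surj a U'a; have [c Wc] := sb z Uz.
  exists c; rewrite -linear_sumZ//.
  have := subspaceD sW' W'z (W'W _ Wc).
  by rewrite addrC [z - _]addrC -scaleN1r lin scaleN1r addrACA subrr addr0 addrC.
Qed.

(** [M] is [W] plus the span of all vectors but the first, [e], of a basis of [U] modulo [W]. It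
    stands for the kernel of a nonzero functional on [U] that vanishes on [W], and [c] is the value
    of that functional at [z]. *)
Lemma hyperplane_mod V (W U : set V) n (b : 'I_n -> V) : subspace W ->
  span_mod W U b -> ~ (U `<=` W) ->
  exists (M : set V) (e : V), [/\ subspace M, W `<=` M, U e, ~ M e &
    forall z, U z -> exists c, M (z - c *: e)].
Proof.
move=> sW sb nUW.
have [m _ [c [Uc ic sc]]] : exists2 m, (m <= n)%N & has_dim W U m.
  by apply: has_dim_bounded => // k c; apply: indep_mod_leq_span sb.
case: m c Uc ic sc => [|m] c Uc ic sc.
  case: nUW => z /sc[a]; by rewrite big_ord0 subr0.
exists [set z | exists2 a : 'I_m.+1 -> K,
  W (z - \sum_(i < m.+1) a i *: c i) & a ord0 = 0], (c ord0); split=> //.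
- split=> [|x u v [a Wa a0] [a' Wa' a'0]].
    exists (fun=> 0) => //; rewrite big1 ?subr0; first by case: sW.
    by move=> i _; rewrite scale0r.
  exists (fun i => x * a i + a' i); last by rewrite a0 a'0 mulr0 addr0.
  have [_ /(_ x _ _ Wa Wa')] := sW; congr W.
  under [in RHS]eq_bigr do rewrite scalerDl -scalerA.
  by rewrite big_split /= -scaler_sumr scalerBr opprD addrACA.
- move=> z Wz; exists (fun=> 0) => //; rewrite big1 ?subr0// => i _.
  by rewrite scale0r.
- case=> a Wa a0.
  have H := ic (fun i => (i == ord0)%:R - a i).
  suff /H/(_ ord0)/eqP : W (\sum_(i < m.+1) ((i == ord0)%:R - a i) *: c i).
    by rewrite a0 eqxx subr0 oner_eq0.
  under eq_bigr do rewrite scalerBl.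
  rewrite big_split /= sumrN (bigD1 ord0)//= scale1r [X in _ + X - _]big1 ?addr0//.
  by move=> i /negbTE->; rewrite scale0r.
- move=> z /sc[a Wa]; exists (a ord0).
  exists (fun i => if i == ord0 then 0 else a i); rewrite ?eqxx//.
  suff -> : \sum_(i < m.+1) (if i == ord0 then 0 else a i) *: c i =
      \sum_(i < m.+1) a i *: c i - a ord0 *: c ord0.
    by rewrite opprB addrA addrNK.
  rewrite (bigD1 ord0)//= scale0r add0r.
  rewrite [in RHS](bigD1 ord0)//= addrAC subrr add0r.
  by apply: eq_bigr => i /negbTE->.
Qed.

End DimensionModulo.

(** * Kernels of wide matrices over an integral domain *)

Section PolynomialKernel.
Import FracField.

Lemma fraction_numden (R : idomainType) (x : {fraction R}) :
  exists p q : R, q != 0 /\ x * @tofrac R q = @tofrac R p.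
Proof.
elim/quotW: x => r; exists \n_r, \d_r; split; first exact: denom_ratioP.
unlock tofrac; rewrite -[LHS]pi_mul; apply/eqmodP => /=.
rewrite equivfE /mulf /= !numden_Ratio ?(oner_neq0, mulf_neq0, denom_ratioP)//.
by rewrite !mulr1 mulrC.
Qed.

End PolynomialKernel.
(** A kernel vector over the field of fractions is multiplied by the product of the denominators of
    its entries. *)
Lemma wide_matrix_kernel_idomain (R : idomainType) m n (A : 'M[R]_(m, n)) :
  (n < m)%N -> exists2 v : 'rV_m, v != 0 & v *m A = 0.
Proof.
move=> /(wide_matrix_kernel (map_mx (@FracField.tofrac R) A))[v v0 vA].
have /choice[p /choice[q pqP]] := fun i => fraction_numden (v 0 i).
have q0 i : q i != 0 := (pqP i).1.
have vq i : v 0 i * FracField.tofrac (q i) = FracField.tofrac (p i) := (pqP i).2.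
exists (\row_i (p i * \prod_(j | j != i) q j)).
  have /rV0Pn[i vi0] := v0; apply/rV0Pn; exists i; rewrite mxE mulf_neq0//.
    by rewrite -tofrac_eq0 -vq mulf_neq0// tofrac_eq0.
  by apply/prodf_neq0.
apply/rowP => j; rewrite !mxE; apply/eqP; rewrite -tofrac_eq0 rmorph_sum.
suff -> : \sum_i FracField.tofrac
     ((\row_i (p i * \prod_(j | j != i) q j)) 0 i * A i j) =
   FracField.tofrac (\prod_i q i) * (v *m map_mx (@FracField.tofrac R) A) 0 j.
  by rewrite vA mxE mulr0.
rewrite mxE mulr_sumr; apply: eq_bigr => i _; rewrite !mxE [in RHS](bigD1 i)//=.
by rewrite !rmorphM /= -vq; ring.
Qed.

(** * Bounded dependence over [K[t]] in a function field *)

Section FunctionFieldDependence.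
Variables (K : finFieldType) (F : fieldType) (iota : {rmorphism K -> F}).

Definition peval (t : F) : {poly K} -> F := horner_eval t \o map_poly iota.
HB.instance Definition _ t := GRing.RMorphism.on (peval t).

Lemma pevalE t p : peval t p = (map_poly iota p).[t].
Proof. by []. Qed.

Lemma pevalC t a : peval t a%:P = iota a.
Proof. by rewrite pevalE map_polyC hornerC. Qed.

Lemma pevalX t : peval t 'X = t.
Proof. by rewrite pevalE map_polyX hornerX. Qed.

Lemma peval_neq0 t p : ~ algebraicOver iota t -> p != 0 -> peval t p != 0.
Proof.
move=> trt p0; apply/eqP => pt; apply: trt.
by exists p; rewrite // rootE -pevalE pt.
Qed.

(* [z] is in the [K(t)]-span of [w], with denominators cleared. *)
Definition rational_span t (J : finType) (w : J -> F) (z : F) : Prop :=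
  exists2 c, peval t c != 0 & exists r : J -> {poly K},
    peval t c * z = \sum_j peval t (r j) * w j.

Lemma rational_span0 t (J : finType) (w : J -> F) : rational_span t w 0.
Proof.
exists 1; first by rewrite rmorph1 oner_eq0.
by exists (fun=> 0); rewrite mulr0 big1// => j _; rewrite rmorph0 mul0r.
Qed.

Lemma rational_span_gen t (J : finType) (w : J -> F) j : rational_span t w (w j).
Proof.
exists 1; first by rewrite rmorph1 oner_eq0.
exists (fun i => (i == j)%:R); rewrite rmorph1 mul1r (bigD1 j)//= eqxx rmorph1 mul1r.
by rewrite big1 ?addr0// => i /negbTE->; rewrite rmorph0 mul0r.
Qed.

Lemma rational_spanD t (J : finType) (w : J -> F) y z :
  rational_span t w y -> rational_span t w z -> rational_span t w (y + z).
Proof.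
move=> [c c0 [r rE]] [d d0 [s sE]].
exists (c * d); first by rewrite rmorphM mulf_neq0.
exists (fun j => d * r j + c * s j).
under eq_bigr do rewrite rmorphD !rmorphM mulrDl -!mulrA.
by rewrite big_split/= -!mulr_sumr -rE -sE rmorphM; ring.
Qed.

Lemma rational_spanM t (J : finType) (w : J -> F) p y :
  rational_span t w y -> rational_span t w (peval t p * y).
Proof.
move=> [c c0 [r rE]]; exists c => //; exists (fun j => p * r j).
under eq_bigr do rewrite rmorphM -mulrA.
by rewrite -mulr_sumr -rE; ring.
Qed.

Lemma rational_spanV t (J : finType) (w : J -> F) p y : peval t p != 0 ->
  rational_span t w (peval t p * y) -> rational_span t w y.
Proof.
move=> p0 [c c0 [r rE]]; exists (c * p); first by rewrite rmorphM mulf_neq0.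
by exists r; rewrite -rE rmorphM mulrA.
Qed.

Lemma rational_span_sum t (J I : finType) (w : J -> F) (z : I -> F) :
  (forall i, rational_span t w (z i)) -> rational_span t w (\sum_i z i).
Proof.
move=> sz; apply: big_ind => //; first exact: rational_span0.
exact: rational_spanD.
Qed.

Lemma rational_span_common t (J I : finType) (w : J -> F) (u : I -> F) :
  (forall i, rational_span t w (u i)) ->
  exists2 q, peval t q != 0 &
    forall i, exists r : J -> {poly K},
      peval t q * u i = \sum_j peval t (r j) * w j.
Proof.
move=> sw; have /choice[c cP] : forall i, exists c, peval t c != 0 /\
    exists r : J -> {poly K}, peval t c * u i = \sum_j peval t (r j) * w j.
  by move=> i; have [c] := sw i; exists c.
have c0 i := (cP i).1.
exists (\prod_i c i).
  by rewrite rmorph_prod prodf_seq_neq0; apply/allP => i _; exact: c0.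
move=> i; have [r rE] := (cP i).2.
exists (fun j => (\prod_(k | k != i) c k) * r j).
under [RHS]eq_bigr do rewrite rmorphM -mulrA.
by rewrite -mulr_sumr -rE (bigD1 i)//= rmorphM; ring.
Qed.

(** Once denominators are cleared, the coordinates of the [u k] form a matrix over [K[t]] with one
    more row than columns. *)
Lemma rational_span_dependent t (J : finType) (w : J -> F)
    (u : 'I_#|J|.+1 -> F) :
  (forall k, rational_span t w (u k)) ->
  exists2 p : 'I_#|J|.+1 -> {poly K}, exists k, p k != 0 &
    \sum_k peval t (p k) * u k = 0.
Proof.
move=> su; have /choice[c /choice[r crP]] : forall k, exists c,
    exists r : J -> {poly K},
    c != 0 /\ peval t c * u k = \sum_j peval t (r j) * w j.
  move=> k; have [c c0 [r rE]] := su k; exists c, r; split=> //.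
  by apply: contra_neq c0 => ->; rewrite rmorph0.
have c0 k := (crP k).1; have rE k := (crP k).2.
have [v /rV0Pn[k vk0] vr] := wide_matrix_kernel_idomain
  (\matrix_(k < #|J|.+1, j < #|J|) r k (enum_val j)) (ltnSn _).
exists (fun k => v 0 k * c k); first by exists k; rewrite mulf_neq0.
under eq_bigr do rewrite rmorphM -mulrA rE mulr_sumr.
rewrite exchange_big big1//= => j _.
under eq_bigr do rewrite mulrA -rmorphM; rewrite -mulr_suml -rmorph_sum.
move/rowP: vr => /(_ (enum_rank j)); rewrite !mxE.
under eq_bigr do rewrite mxE enum_rankK; move=> ->.
by rewrite rmorph0 mul0r.
Qed.

Lemma peval_swapXY (P : {poly {poly K}}) x t :
  (map_poly (peval t) (swapXY P)).[x] = (map_poly (peval x) P).[t].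
Proof.
have E y (Q : {poly {poly K}}) : map_poly (peval y) Q =
    map_poly (horner_eval y) (map_poly (map_poly iota) Q).
  by rewrite -map_poly_comp.
by rewrite !E -swapXY_map -!horner_swapXY swapXYK horner2_swapXY.
Qed.

(* A dependence over [K[x]] between the powers of [t], read with the two
   variables swapped, is an equation of [x] over [K[t]]; pseudo-division by it
   bounds the degree in [x]. *)
Lemma transcendental_dependence t : function_field iota ->
  ~ algebraicOver iota t ->
  exists N, forall u : 'I_N.+1 -> F,
    exists2 p : 'I_N.+1 -> {poly K}, exists k, p k != 0 &
      \sum_k peval t (p k) * u k = 0.
Proof.
move=> [x [trx [n [b bspan]]]] trt.
have spanx z : rational_span x b z.
  have [c [cx ->]] := bspan z; apply: rational_span_sum => i.
  have [p [q [q0 ->]]] := cx i.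
  apply: (rational_spanV q0); rewrite -!pevalE.
  rewrite mulrA mulrCA divff// mulr1.
  exact/rational_spanM/rational_span_gen.
have [p [k pk0] pE] := rational_span_dependent
  (u := fun k => t ^+ k) (fun k => spanx (t ^+ k)).
pose S := swapXY (\poly_(i < #|'I_n|.+1) p (inord i)).
have S0 : S != 0.
  rewrite swapXY_eq0; apply: contra_neq pk0 => P0.
  by have /polyP/(_ k) := P0; rewrite coef_poly ltn_ord inord_val coef0.
have Sx : (map_poly (peval t) S).[x] = 0.
  rewrite peval_swapXY (horner_coef_wide _ (n := #|'I_n|.+1)).
    rewrite -[RHS]pE; apply: eq_bigr => i _.
    by rewrite coef_map coef_poly ltn_ord inord_val.
  by apply: leq_trans (size_poly _ _) _; rewrite size_poly.
pose d := (size S).-1.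
have spant i q : rational_span t
    (fun ij : 'I_n * 'I_d => x ^+ ij.2 * b ij.1) (peval x q * b i).
  have := Pdiv.Idomain.divp_eq (map_poly polyC q) S.
  move=> /(congr1 (fun R => (map_poly (peval t) R).[x])).
  rewrite /= map_polyZ hornerZ rmorphD rmorphM hornerD hornerM Sx mulr0 add0r.
  have -> : (map_poly (peval t) (map_poly polyC q)).[x] = peval x q.
    rewrite -map_poly_comp pevalE; congr (_.[x]).
    by apply: eq_map_poly => a /=; rewrite pevalC.
  (* Pseudo-division has multiplied by a power of the leading coefficient of [S], a nonzero
     polynomial in [t]; its value is nonzero because [t] is transcendental. *)
  move=> E; apply: (@rational_spanV _ _ _
    (lead_coef S ^+ Pdiv.Idomain.scalp (map_poly polyC q) S)).
    by rewrite peval_neq0// expf_neq0// lead_coef_eq0.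
  rewrite mulrA E (horner_coef_wide _ (n := d)); last first.
    apply: leq_trans (size_poly _ _) _.
    by rewrite -ltnS prednK ?size_poly_gt0// Pdiv.Idomain.ltn_modp.
  rewrite mulr_suml; apply: rational_span_sum => j.
  rewrite coef_map -mulrA; apply: rational_spanM.
  exact: (rational_span_gen _ _ (i, j)).
exists #|{: 'I_n * 'I_d}| => u.
have [q q0 qE] := rational_span_common (fun k => spanx (u k)).
have [k'|v v0 vE] := rational_span_dependent (t := t)
  (w := fun ij : 'I_n * 'I_d => x ^+ ij.2 * b ij.1)
  (u := fun k => peval x q * u k).
  have [r ->] := qE k'; apply: rational_span_sum => i; exact: spant.
exists v => //; apply: (mulfI q0); rewrite mulr0 mulr_sumr -[RHS]vE.
by apply: eq_bigr => i _; rewrite mulrCA.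
Qed.

(** If every [p k] has zero constant term, the relation can be divided by [z], which lowers the
    total size of the [p k]. When this stops, the constant terms give the [c k], and everything else
    carries a factor [z]. *)
Lemma dependence_neq0_at0 N (z : F) (u : 'I_N -> F) (p : 'I_N -> {poly K}) :
  z != 0 -> (exists k, p k != 0) -> \sum_k peval z (p k) * u k = 0 ->
  exists (c : 'I_N -> K) (q : 'I_N -> {poly K}), (exists k, c k != 0) /\
    \sum_k iota (c k) * u k = z * \sum_k peval z (q k) * u k.
Proof.
move=> z0; pose m p := (\sum_(k < N) size (p k : {poly K}))%N.
have [M] := ubnP (m p); elim: M p => // M IH p mp [k pk] pE.
have divX (f : {poly K}) : exists g, f = g * 'X + (f.[0])%:P.
  have /factor_theorem[g gE] : root (f - (f.[0])%:P) 0.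
    by rewrite rootE !hornerE subrr.
  by exists g; rewrite -(subr0 'X) -gE subrK.
have /choice[q pq] := fun j => divX (p j).
have E : \sum_k iota (p k).[0] * u k = z * \sum_k peval z (- q k) * u k.
  apply/eqP; rewrite -subr_eq0 -[X in _ == X]pE; apply/eqP.
  rewrite mulr_sumr -sumrB; apply: eq_bigr => j _.
  have -> : peval z (p j) = peval z (q j) * z + iota (p j).[0].
    by rewrite {1}pq rmorphD rmorphM /= pevalC pevalX.
  by rewrite rmorphN; ring.
have [/existsP[j pj0]|] := boolP [exists j, (p j).[0] != 0].
  by exists (fun j => (p j).[0]), (fun j => - q j); split=> //; exists j.
rewrite negb_exists => /forallP H.
have p0 j : (p j).[0] = 0 by apply/eqP; have := H j; rewrite negbK.
have pqX j : p j = q j * 'X by rewrite {1}pq p0 addr0.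
have qk : q k != 0 by apply: contra_neq pk => qk0; rewrite pqX qk0 mul0r.
apply: (IH q); last 1 first.
- apply: (mulfI z0); rewrite mulr0 mulr_sumr -[RHS]pE; apply: eq_bigr => j _.
  by rewrite [in RHS]pqX rmorphM /= pevalX; ring.
- rewrite -ltnS; apply: leq_trans mp; rewrite ltnS.
  rewrite /m (bigD1 k)//= [ltnRHS](bigD1 k)//= -addSn leq_add//.
    by rewrite pqX size_mulX.
  apply: leq_sum => j _; rewrite pqX.
  by have [->|qj] := eqVneq (q j) 0; rewrite ?mul0r// size_mulX.
- by exists k.
Qed.

(** Serves to bound dimensions: where [z] has a zero, the right-hand side has larger valuation than
    the [u k] are known to have. So any [N + 1] elements are [K]-dependent modulo a space that
    requires this larger valuation. *)
Lemma nonconstant_dependence z : function_field iota ->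
  full_constant_field iota -> (forall a, z <> iota a) ->
  exists N, forall u : 'I_N.+1 -> F,
    exists (c : 'I_N.+1 -> K) (q : 'I_N.+1 -> {poly K}),
    (exists k, c k != 0) /\
    \sum_k iota (c k) * u k = z * \sum_k peval z (q k) * u k.
Proof.
move=> FF Kfull zK; have [|N NP] := @transcendental_dependence z FF.
  by move=> /Kfull[a]; exact: zK.
exists N => u; have [p p0 pE] := NP u.
apply: dependence_neq0_at0 p0 pE; apply/eqP => z0.
by apply: (zK 0); rewrite rmorph0.
Qed.

End FunctionFieldDependence.

Lemma indep_mod_widen (K : fieldType) (V : lmodType K) (W : set V) m n
    (b : 'I_n -> V) (le_mn : (m <= n)%N) :
  indep_mod W b -> indep_mod W (b \o widen_ord le_mn).
Proof.
move=> ib a Wa i.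
have := ib (fun j => oapp a 0 (insub (val j))).
suff -> : \sum_(j < n) oapp a 0 (insub (val j)) *: b j =
    \sum_(j < m) a j *: (b \o widen_ord le_mn) j.
  by move=> /(_ Wa (widen_ord le_mn i)); rewrite /= valK.
rewrite (bigID (fun j : 'I_n => (j < m)%N)) /= big_ord_narrow /=.
rewrite [X in _ + X]big1 ?addr0 => [|j /negbTE jm].
  by apply: eq_bigr => j _; rewrite valK.
by rewrite insubF//= scale0r.
Qed.

(* [iota] is a phantom argument, selecting the [K]-module structure on [F]. *)
Definition constant_module (K F : fieldType) (iota : {rmorphism K -> F}) : Type :=
  F.

(** * [F] as a vector space over [K] *)

Section ConstantModule.
Variables (K F : fieldType) (iota : {rmorphism K -> F}).
Local Notation Fm := (constant_module iota).

HB.instance Definition _ := GRing.Zmodule.on Fm.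

Let scale (a : K) (z : Fm) : Fm := iota a * z.

Let scaleA a b z : scale a (scale b z) = scale (a * b) z.
Proof. by rewrite /scale rmorphM mulrA. Qed.
Let scale1 : left_id 1 scale.
Proof. by move=> z; rewrite /scale rmorph1 mul1r. Qed.
Let scaleDr : right_distributive scale +%R.
Proof. by move=> a y z; rewrite /scale mulrDr. Qed.
Let scaleDl z : {morph scale^~ z : a b / a + b}.
Proof. by move=> a b; rewrite /scale rmorphD mulrDl. Qed.

HB.instance Definition _ := GRing.Zmodule_isLmodule.Build K Fm
  scaleA scale1 scaleDr scaleDl.

Lemma constant_scaleE (a : K) (z : Fm) : a *: z = iota a * (z : F).
Proof. by []. Qed.

End ConstantModule.

(** * Places and finiteness of their degrees *)

Section Places.
Variables (K : finFieldType) (F : fieldType) (iota : {rmorphism K -> F}).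
Local Notation Fm := (constant_module iota).
Implicit Types (P Q : place iota) (z y t : F) (D E : place iota -> int).

Lemma place_const P (a : K) : P (iota a) = 0.
Proof.
have [->|a0] := eqVneq a 0; first by rewrite rmorph0 valuation0.
exact: valuation_const.
Qed.

Lemma place1 P : P 1 = 0.
Proof. by rewrite -(rmorph1 iota) place_const. Qed.

Lemma placeV P z : P z^-1 = - P z.
Proof.
have [->|z0] := eqVneq z 0; first by rewrite invr0 valuation0 oppr0.
apply/eqP; rewrite -addr_eq0 -valuationM ?invr_neq0//.
by rewrite mulVf// place1.
Qed.

Lemma placeXn P z n : P (z ^+ n) = P z *+ n.
Proof.
have [->|z0] := eqVneq z 0.
  by rewrite valuation0 mul0rn expr0n; case: eqP; rewrite ?place1 ?valuation0.
elim: n => [|n IH]; first by rewrite expr0 place1.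
by rewrite exprS valuationM ?expf_neq0// IH mulrS.
Qed.

Lemma placeXz P z (n : int) : P (z ^ n) = P z * n.
Proof.
case: n => n; first by rewrite -exprnP placeXn -mulr_natr natz.
by rewrite NegzE -exprnN placeV placeXn mulrN -mulr_natr natz.
Qed.

(* [P z >= e], with the convention that this always holds for [z = 0]. *)
Definition vge P (e : int) z : Prop := z != 0 -> e <= P z.

Lemma vge0 P e : vge P e 0.
Proof. by rewrite /vge eqxx. Qed.

Lemma vge_le P e e' z : e' <= e -> vge P e z -> vge P e' z.
Proof. by move=> ee' H /H; apply: le_trans. Qed.

Lemma vgeD P e y z : vge P e y -> vge P e z -> vge P e (y + z).
Proof.
have [->|y0] := eqVneq y 0; first by rewrite add0r.
have [->|z0] := eqVneq z 0; first by rewrite addr0.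
move=> /(_ y0) yP /(_ z0) zP yz0; apply: le_trans (valuationD P y0 z0 yz0).
by rewrite le_min yP.
Qed.

Lemma vgeM P e e' y z : vge P e y -> vge P e' z -> vge P (e + e') (y * z).
Proof.
move=> yP zP; rewrite /vge mulf_eq0 negb_or => /andP[y0 z0].
by rewrite valuationM// lerD ?yP ?zP.
Qed.

Lemma vge_const P a : vge P 0 (iota a).
Proof. by move=> _; rewrite place_const. Qed.

Lemma vgeZ P e a z : vge P e z -> vge P e (iota a * z).
Proof. by rewrite -[e in X in _ -> X]add0r; apply/vgeM/vge_const. Qed.

Lemma vge_sum P e (I : finType) (z : I -> F) :
  (forall i, vge P e (z i)) -> vge P e (\sum_i z i).
Proof.
move=> H; apply: big_ind => //; first exact: vge0.
by move=> y w yP wP; exact: vgeD.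
Qed.

Lemma vge_peval P z p : vge P 0 z -> vge P 0 (peval iota z p).
Proof.
move=> zP; elim/poly_ind: p => [|p c IH]; first by rewrite rmorph0; apply: vge0.
rewrite rmorphD rmorphM /= pevalC pevalX.
by apply: vgeD; [rewrite -[0]addr0; apply: vgeM|apply: vge_const].
Qed.

Lemma vge_subspace P e : subspace [set z : Fm | vge P e z].
Proof.
split=> [|a y z]; first exact: vge0.
by move=> yP zP; exact: (vgeD (vgeZ (a := a) yP) zP).
Qed.

Lemma place_nonconst P z : P z != 0 -> forall a, z <> iota a.
Proof. by move=> Pz a za; move: Pz; rewrite za place_const. Qed.

Lemma dim_modE (W V : set Fm) n : subspace W -> has_dim W V n ->
  dim_mod iota V W = n.
Proof.
move=> sW hn; apply: (has_dim_inj sW (V := Fm) (U := V)) => //.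
have [b [? ? ?]] := @xgetI _ 0%N
  [set n | exists b : 'I_n -> F, basis_mod iota V W b] n hn.
by exists b; split.
Qed.

(** [0] is the default of [xget], so only a positive value certifies that a basis exists. *)
Lemma dim_mod_gt0 (W V : set Fm) : (0 < dim_mod iota V W)%N ->
  has_dim W V (dim_mod iota V W).
Proof. by rewrite {1}/dim_mod; case: xgetP. Qed.

Hypothesis FF : function_field iota.
Hypothesis Kfull : full_constant_field iota.

(** For a uniformizer [t], [nonconstant_dependence] relates any [N + 1] elements of the valuation
    ring modulo [t] times that ring, hence modulo the maximal ideal; so the residue field has
    dimension at most [N]. *)
Lemma has_dim_place_degree P : has_dim (maximal_ideal P : set Fm)
  (valuation_ring P) (place_degree P).
Proof.
have [t t0 Pt] := valuation_normalized P.
have [|N HN] := @nonconstant_dependence _ _ _ t FF Kfull.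
  by apply: (@place_nonconst P); rewrite Pt.
have sm : subspace (maximal_ideal P : set Fm) by exact: (vge_subspace P 1).
have [|n _ dn] := @has_dim_bounded _ Fm (maximal_ideal P) (valuation_ring P) N sm;
  last by rewrite /place_degree (dim_modE sm dn).
move=> n b Ub ib; rewrite leqNgt; apply/negP => ltNn.
have [c [q [[k ck0] E]]] := HN (b \o widen_ord ltNn).
case/eqP: ck0; suff W : vge P 1 (\sum_k iota (c k) * (b \o widen_ord ltNn) k).
  exact: (@indep_mod_widen _ _ _ _ _ _ ltNn ib c W k).
rewrite E -[1]addr0; apply: vgeM; first by move=> _; rewrite Pt.
apply: vge_sum => j; rewrite -[0]addr0; apply: vgeM; last exact: Ub.
by apply: vge_peval => _; rewrite Pt.
Qed.

Lemma place_degree_gt0 P : (0 < place_degree P)%N.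
Proof.
have [b [_ _ sb]] := has_dim_place_degree P; rewrite lt0n; apply/eqP => d0.
have [|a] := sb (1 : F); first by move=> _; rewrite place1.
rewrite big1 ?subr0 => [|i _]; last by have := ltn_ord i; rewrite {2}d0.
by move=> /(_ (oner_neq0 F)); rewrite place1.
Qed.

End Places.

Lemma has_dim_refl (K : fieldType) (V : lmodType K) (W : set V) :
  has_dim W W 0.
Proof.
exists (fun=> 0); split=> [[]//|a _ []//|z Wz].
by exists (fun=> 0); rewrite big_ord0 subr0.
Qed.

(** * Divisors, their degrees, and adeles bounded by a divisor *)

Section Divisors.
Variables (K : finFieldType) (F : fieldType) (iota : {rmorphism K -> F}).
Local Notation Fm := (constant_module iota).
Implicit Types (P Q : place iota) (z : F) (D E : place iota -> int).

Lemma divisor_sub D E : (forall P, E P = 0 -> D P = 0) -> divisor E -> divisor D.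
Proof.
move=> ED; apply: sub_finite_set => P /=.
by apply: contra_neq => /ED.
Qed.

Lemma divisor_sub2 D E E' : (forall P, E P = 0 -> E' P = 0 -> D P = 0) ->
  divisor E -> divisor E' -> divisor D.
Proof.
move=> ED dE dE'; have fin := conj dE dE'; move: fin; rewrite -finite_setU.
apply: sub_finite_set => P /= /eqP DP.
by have [EP|] := eqVneq (E P) 0; [right|left] => //; apply/eqP => /(ED P EP).
Qed.

Lemma divisor0 : divisor (fun _ : place iota => 0).
Proof.
by apply: (@sub_finite_set _ _ set0) => // P /=; rewrite eqxx.
Qed.

Lemma divisorD D E : divisor D -> divisor E -> divisor (fun P => D P + E P).
Proof. by apply: divisor_sub2 => P -> ->; rewrite addr0. Qed.

Lemma divisor_max D E : divisor D -> divisor E ->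
  divisor (fun P => Num.max (D P) (E P)).
Proof. by apply: divisor_sub2 => P -> ->; rewrite maxxx. Qed.

Lemma divisor_bigmax (I : finType) (D : I -> place iota -> int) E :
  divisor E -> (forall i, divisor (D i)) ->
  divisor (fun P => \big[Num.max/E P]_i D i P).
Proof.
move=> dE dD; elim: (index_enum I) => [|i s IH].
  by apply: divisor_sub dE => P; rewrite big_nil.
apply: divisor_sub2 (dD i) IH => P D0.
by rewrite big_cons => ->; rewrite D0 maxxx.
Qed.

(** Effective divisors as lists of places with multiplicity, which allows induction by adding one
    place at a time. *)
Definition seq_divisor (s : seq (place iota)) : place iota -> int :=
  fun P => (count_mem P s)%:Z.

Lemma divisor_seq s : divisor (seq_divisor s).
Proof.
apply: (@sub_finite_set _ _ [set` s]); last exact: finite_seq.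
move=> P /=; rewrite /seq_divisor; apply: contraNT => Ps.
by have /count_memPn -> := Ps.
Qed.

Lemma divisor_degreeE D s : uniq s -> (forall P, D P != 0 -> P \in s) ->
  divisor_degree D = \sum_(P <- s) D P * (place_degree P)%:Z.
Proof.
move=> us Ds; rewrite /divisor_degree (fsbigE s)//.
  by apply: eq_bigl => P; rewrite in_setT.
move=> P _ Ps; have [->|/Ds] := eqVneq (D P) 0; first by rewrite mul0r.
by move=> h; rewrite h in Ps.
Qed.

Lemma divisor_support D : divisor D ->
  exists2 s, uniq s & forall P, D P != 0 -> P \in s.
Proof.
move=> /finite_seqP[s sE]; exists (undup s); first exact: undup_uniq.
move=> P DP; rewrite mem_undup; have : [set P | D P != 0] P by [].
by rewrite sE.
Qed.

Lemma divisor_degreeD D E : divisor D -> divisor E ->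
  divisor_degree (fun P => D P + E P) = divisor_degree D + divisor_degree E.
Proof.
move=> /divisor_support[s us Ds] /divisor_support[s' us' Es].
have uu := undup_uniq (s ++ s').
rewrite !(divisor_degreeE uu) => [|P|P|P].
- by rewrite -big_split; apply: eq_bigr => P _; rewrite mulrDl.
- by move=> /Es; rewrite mem_undup mem_cat orbC => ->.
- by move=> /Ds; rewrite mem_undup mem_cat => ->.
- have [->|/Ds] := eqVneq (D P) 0; last by rewrite mem_undup mem_cat => ->.
  by rewrite add0r => /Es; rewrite mem_undup mem_cat orbC => ->.
Qed.

Lemma divisor_degree_seq s :
  divisor_degree (seq_divisor s) = (\sum_(P <- s) place_degree P)%:Z.
Proof.
elim: s => [|P s IH].
  by rewrite (@divisor_degreeE _ [::])// !big_nil.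
have -> : seq_divisor (P :: s) = (fun Q => seq_divisor [:: P] Q + seq_divisor s Q).
  by apply/funext => Q; rewrite /seq_divisor /= addn0 PoszD.
rewrite divisor_degreeD; try exact: divisor_seq.
rewrite IH big_cons PoszD (@divisor_degreeE _ [:: P])//; last first.
  move=> Q; rewrite /seq_divisor /= addn0 inE [P == Q]eq_sym.
  by case: (Q == P).
by rewrite big_seq1 /seq_divisor /= eqxx mul1r.
Qed.

Lemma count_mem_flatten_nseq (n : place iota -> nat) s P : uniq s ->
  count_mem P (flatten [seq nseq (n Q) Q | Q <- s]) = if P \in s then n P else 0%N.
Proof.
elim: s => //= Q s IH /andP[Qs us]; rewrite count_cat count_nseq IH// in_cons /=.
have [<-|QP] := eqVneq Q P; last by rewrite mul0n add0n.
by rewrite (negbTE Qs) mul1n addn0.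
Qed.

Lemma seq_divisor_diff D E : divisor D -> divisor E ->
  (forall P, D P <= E P) -> exists s, E = (fun P => D P + seq_divisor s P).
Proof.
move=> dD dE DE.
have [s us sP] : exists2 s, uniq s & forall P, E P - D P != 0 -> P \in s.
  apply: (@divisor_support (fun P => E P - D P)).
  by apply: divisor_sub2 dE dD => P -> ->; rewrite subr0.
exists (flatten [seq nseq `|E P - D P|%N P | P <- s]); apply/funext => P.
rewrite /seq_divisor (count_mem_flatten_nseq (fun P => `|E P - D P|%N))//.
apply/eqP; rewrite [_ + Posz _]addrC -subr_eq; case: ifPn => [_|Ps].
  by rewrite gez0_abs ?subr_ge0.
by have [//|/sP] := eqVneq (E P - D P) 0; rewrite (negbTE Ps).
Qed.

(* Adeles bounded by [D], without finiteness condition on the components. *)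
Definition adele_space D : set (place iota -> Fm) :=
  [set a | forall P, vge P (- D P) (a P)].

Definition diag (z : Fm) : place iota -> Fm := fun=> z.

Lemma diag_linear : linear diag.
Proof. by []. Qed.

Lemma adele_space_subspace D : subspace (adele_space D).
Proof.
split=> [P|a u v uD vD P]; first exact: vge0.
by apply: vgeD (vD P); apply: vgeZ; exact: uD.
Qed.

Lemma adele_space_le D E : (forall P, D P <= E P) ->
  adele_space D `<=` adele_space E.
Proof. by move=> DE a aD P; apply: vge_le (aD P); rewrite lerN2. Qed.

Lemma riemann_roch_spaceE D :
  riemann_roch_space D = [set z | adele_space D (diag z)].
Proof.
by apply/seteqP; split=> z /= zD; [move=> P z0|move=> z0 P]; exact: zD.
Qed.

Lemma riemann_roch_subspace D : subspace (riemann_roch_space D : set Fm).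
Proof.
rewrite riemann_roch_spaceE; have [A0 AD] := adele_space_subspace D.
by split=> [|a u v uD vD]; [exact: A0|exact: AD].
Qed.

Lemma riemann_roch_le D E : (forall P, D P <= E P) ->
  riemann_roch_space D `<=` riemann_roch_space E.
Proof.
by move=> DE z; rewrite !riemann_roch_spaceE; exact: adele_space_le.
Qed.

Hypothesis FF : function_field iota.
Hypothesis Kfull : full_constant_field iota.

(** Only the component at [P] changes. There, multiplication by [u], whose valuation [- (D P + 1)]
    is the lowest one newly allowed, carries the valuation ring modulo its maximal ideal onto the
    quotient. *)
Lemma has_dim_adele_point D P : has_dim (adele_space D)
  (adele_space (fun Q => D Q + seq_divisor [:: P] Q)) (place_degree P).
Proof.
have [t t0 Pt] := valuation_normalized P.
pose u := t ^ (- (D P + 1)).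
have u0 : u != 0 by rewrite expfz_neq0.
have Pu : P u = - (D P + 1) by rewrite placeXz Pt mul1r.
have PuV : P u^-1 = D P + 1 by rewrite placeV Pu opprK.
have sP Q : seq_divisor [:: P] Q = (Q == P)%:R.
  by rewrite /seq_divisor /= addn0 eq_sym; case: (Q == P).
apply: (has_dim_transport
  (phi := fun z : Fm => (fun Q => if Q == P then u * z else 0) : place iota -> Fm)
  (W := maximal_ideal P : set Fm) (U := valuation_ring P)).
- move=> a y z; apply/funext => Q; rewrite !fctE.
  by case: (Q == P); rewrite !constant_scaleE ?mulrDr ?mulr0 ?addr0 1?mulrCA.
- exact: adele_space_subspace.
- move=> z zP Q; rewrite sP; case: eqP => [->|_]; last exact: vge0.
  rewrite -[- _]addr0; apply: vgeM zP; by rewrite /vge Pu.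
- move=> z zP /(_ P); rewrite eqxx => H z0.
  have := H; rewrite /vge mulf_neq0// valuationM// Pu => /(_ isT); lia.
- move=> z zP Q; case: eqP => [->|_]; last exact: vge0.
  move=> uz; have z0 : z != 0 by apply: contra_neq uz => ->; rewrite mulr0.
  rewrite valuationM// Pu; have := zP z0; lia.
- move=> a aP; exists (u^-1 * a P).
    have := aP P; rewrite sP eqxx => H.
    have : vge P (D P + 1 - (D P + 1)) (u^-1 * a P).
      by apply: vgeM H => _; rewrite PuV.
    by rewrite subrr.
  move=> Q; rewrite !fctE; case: eqP => [->|/eqP QP].
    by rewrite mulrA divff// mul1r subrr; exact: vge0.
  by have := aP Q; rewrite sP (negbTE QP) addr0 subr0.
- exact: (vge_subspace P 0).
- exact: has_dim_place_degree.
Qed.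

Lemma has_dim_adele_seq D s : has_dim (adele_space D)
  (adele_space (fun Q => D Q + seq_divisor s Q)) (\sum_(P <- s) place_degree P).
Proof.
elim: s D => [|P s IH] D.
  rewrite big_nil; suff -> : (fun Q => D Q + seq_divisor [::] Q) = D.
    exact: has_dim_refl.
  by apply/funext => Q; rewrite addr0.
pose D' := fun Q => D Q + seq_divisor [:: P] Q.
have E : (fun Q => D Q + seq_divisor (P :: s) Q) = (fun Q => D' Q + seq_divisor s Q).
  by apply/funext => Q; rewrite /D' /seq_divisor /= addn0 PoszD addrA.
have pos s' Q : 0 <= seq_divisor s' Q by [].
rewrite big_cons; apply: (has_dimD (U := adele_space D')).
- exact: adele_space_subspace.
- by apply: adele_space_le => Q; rewrite lerDl pos.
- by rewrite E; apply: adele_space_le => Q; rewrite lerDl pos.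
- exact: has_dim_adele_point.
- by rewrite E; exact: IH.
Qed.

(** For adeles the dimension of a quotient is exactly a difference of degrees; statements on degrees
    thereby become linear algebra. *)
Lemma has_dim_adele D E : divisor D -> divisor E -> (forall P, D P <= E P) ->
  exists2 n, has_dim (adele_space D) (adele_space E) n &
    divisor_degree E = divisor_degree D + n%:Z.
Proof.
move=> dD dE /(seq_divisor_diff dD dE)[s ->].
exists (\sum_(P <- s) place_degree P)%N; first exact: has_dim_adele_seq.
by rewrite divisor_degreeD ?divisor_degree_seq//; exact: divisor_seq.
Qed.

End Divisors.

(** * Riemann-Roch spaces and finiteness of zeros *)

Section Genus.
Variables (K : finFieldType) (F : fieldType) (iota : {rmorphism K -> F}).
Local Notation Fm := (constant_module iota).
Implicit Types (P Q : place iota) (z : F) (D E : place iota -> int).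
Hypothesis FF : function_field iota.
Hypothesis Kfull : full_constant_field iota.
Variable g : nat.
Hypothesis g_genus : is_genus iota g.
Variable Q0 : place iota.

Local Notation rr D := (riemann_roch_space D : set Fm).
Local Notation diag := (@diag _ _ iota).

Lemma diag_sum n (a : 'I_n -> K) (b : 'I_n -> Fm) :
  \sum_i a i *: diag (b i) = diag (\sum_i a i *: b i).
Proof. by rewrite (linear_sumZ (phi := diag)). Qed.

Lemma indep_mod_diag D n (b : 'I_n -> Fm) : indep_mod (rr D) b ->
  indep_mod (adele_space D) (fun i => diag (b i)).
Proof.
move=> ib a; rewrite diag_sum => Da; apply: ib.
by rewrite riemann_roch_spaceE.
Qed.

(** The diagonal embeds [L(E) / L(D)] into the quotient of the adele spaces of [E] and [D], of
    dimension [deg E - deg D]. *)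
Lemma has_dim_rr_mod D E : divisor D -> divisor E -> (forall P, D P <= E P) ->
  exists2 l, has_dim (rr D) (rr E) l &
    divisor_degree D + l%:Z <= divisor_degree E.
Proof.
move=> dD dE DE.
have [n [b [_ _ sb]] ->] := has_dim_adele FF Kfull dD dE DE.
have [|l ln dl] := @has_dim_bounded _ Fm (rr D) (rr E) n
  (riemann_roch_subspace D); last by exists l => //; rewrite lerD2l lez_nat.
move=> k c Ec ic; apply: (indep_mod_leq_span (adele_space_subspace D) sb
  (c := fun i => diag (c i))).
  by move=> i; have := Ec i; rewrite riemann_roch_spaceE.
exact: indep_mod_diag.
Qed.

Lemma zero_subspace (V : lmodType K) : subspace [set 0 : V].
Proof. by split=> // a u v -> ->; rewrite scaler0 addr0. Qed.

Lemma divisor_degree_ell D : divisor D ->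
  divisor_degree D - (ell D)%:Z + 1 <= g%:Z.
Proof. by move=> dD; apply: g_genus.2. Qed.

(* [dim_mod] is [0] on infinite-dimensional spaces, but the genus inequality
   excludes [ell D1 = 0] for [D1 = g Q0]; other spaces are compared to this one. *)
Lemma has_dim_ell D : divisor D -> has_dim [set 0] (rr D) (ell D).
Proof.
move=> dD; pose D1 := seq_divisor (nseq g Q0).
have dD1 : divisor D1 := divisor_seq _.
have d1 : has_dim [set 0] (rr D1) (ell D1).
  suff : (0 < ell D1)%N by exact: dim_mod_gt0.
  have := divisor_degree_ell dD1.
  rewrite divisor_degree_seq big_nseq iter_addn_0.
  have : (g <= place_degree Q0 * g)%N by rewrite leq_pmull// place_degree_gt0.
  lia.
pose E := fun P => Num.max (D P) (D1 P).
have [|l dl _] := @has_dim_rr_mod D1 E dD1 (divisor_max dD dD1).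
  by move=> P; rewrite le_max lexx orbT.
have dE : has_dim [set 0] (rr E) (ell D1 + l).
  apply: has_dimD dl => //; first exact: riemann_roch_subspace.
    by move=> _ ->; case: (riemann_roch_subspace D1).
  by apply: riemann_roch_le => P; rewrite le_max lexx orbT.
have [|n _ dn] := has_dim_sub (zero_subspace _) (U := rr D) _ dE.
  by apply: riemann_roch_le => P; rewrite le_max lexx.
by rewrite /ell (dim_modE (zero_subspace _) dn).
Qed.

Lemma ell_add D E l : divisor D -> divisor E -> (forall P, D P <= E P) ->
  has_dim (rr D) (rr E) l -> ell E = (ell D + l)%N.
Proof.
move=> dD dE DE dl; apply: (has_dim_inj (zero_subspace _) (has_dim_ell dE)).
apply: has_dimD (has_dim_ell dD) dl; first exact: riemann_roch_subspace.
  by move=> _ ->; case: (riemann_roch_subspace D).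
exact: riemann_roch_le.
Qed.

(** All powers of [z] lie in the finite-dimensional space [L(0)], whereas those of a transcendental
    element are independent. *)
Lemma rr0_algebraic z : (forall P, vge P 0 z) -> algebraicOver iota z.
Proof.
move=> z_ge0; apply: contrapT => trz.
have := has_dim_ell (divisor0 iota); set e := ell _ => -[b [_ _ sb]].
suff : (e.+1 <= e)%N by rewrite ltnn.
apply: (indep_mod_leq_span (zero_subspace _) sb
  (c := (fun i => z ^+ i) : 'I_e.+1 -> Fm)) => [i|a a0 i].
  move=> zi0 P; rewrite oppr0; move: zi0; rewrite -/(vge P 0 (z ^+ i)).
  have -> : z ^+ i = peval iota z ('X^i) by rewrite rmorphXn /= pevalX.
  exact: vge_peval.
pose p := \poly_(j < e.+1) a (inord j).
have pz : peval iota z p = 0.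
  rewrite pevalE (horner_coef_wide _ (n := e.+1)).
    rewrite -[RHS]a0; apply: eq_bigr => j _.
    by rewrite coef_map coef_poly ltn_ord inord_val.
  by apply: leq_trans (size_poly _ _) _; rewrite size_poly.
have p0 : p = 0.
  by apply: contrapT => /eqP /(peval_neq0 trz); rewrite pz eqxx.
by have /polyP/(_ i) := p0; rewrite coef_poly ltn_ord inord_val coef0.
Qed.

Lemma ell0 : ell (fun _ : place iota => 0) = 1%N.
Proof.
apply: (dim_modE (zero_subspace _)).
exists (fun=> 1); split.
- by move=> _ _ P; rewrite place1.
- move=> a; rewrite big_ord1 constant_scaleE mulr1 => a0 i.
  by rewrite ord1; apply: (fmorph_inj iota); rewrite rmorph0.
- move=> z zD; have [|a za] := Kfull (z := z).
    by apply: rr0_algebraic => P z0; have := zD z0 P; rewrite oppr0.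
  by exists (fun=> a); rewrite big_ord1 constant_scaleE mulr1 za subrr.
Qed.

(* If [D] is a sum of [r] distinct zeros of [z], elements of [L(D)] that are
   [K]-independent modulo [L(0)] are [K[z]]-independent, so that [ell D], hence
   also [r], is bounded. *)
Lemma finite_zeros z : finite_set [set P : place iota | 0 < P z].
Proof.
have [[a ->]|zK] := pselect (exists a, z = iota a).
  by apply: (@sub_finite_set _ _ set0) => // P /=; rewrite place_const.
have [|N HN] := @nonconstant_dependence _ _ _ z FF Kfull.
  by move=> a za; apply: zK; exists a.
apply: contrapT => /(@infinite_set_fset _ _ (g + N).+1)[B Bz szB].
pose s : seq (place iota) := finmap.enum_fset B.
have us : uniq s := finmap.fset_uniq B.
have sz P : P \in s -> 0 < P z by exact: Bz.
pose D := seq_divisor s.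
have dD : divisor D := divisor_seq _.
have D0 P : 0 <= D P by [].
have [l dl _] := has_dim_rr_mod (divisor0 iota) dD D0.
have := divisor_degree_ell dD.
rewrite (ell_add (divisor0 iota) dD D0 dl) ell0 divisor_degree_seq.
have szD : (size s <= \sum_(P <- s) place_degree P)%N.
  rewrite -sum1_size; apply: leq_sum => P _; exact: place_degree_gt0.
have szs : (g + N < size s)%N := szB.
(* Since [ell D = 1 + l], the genus inequality gives [size s <= deg D <= g + l], while [s] was
   chosen longer than [g + N]. *)
suff : (l <= N)%N by lia.
have [b [Db ib _]] := dl.
rewrite leqNgt; apply/negP => ltNl.
have [c [q [[k ck0] E]]] := HN (b \o widen_ord ltNl).
case/eqP: ck0.
suff W : rr (fun _ : place iota => 0) (\sum_k c k *: (b \o widen_ord ltNl) k).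
  exact: (@indep_mod_widen _ _ _ _ _ _ ltNl ib c W k).
have rrD : rr D (\sum_k c k *: (b \o widen_ord ltNl) k).
  by apply: subspace_sum; [exact: riemann_roch_subspace|move=> i; exact: Db].
rewrite riemann_roch_spaceE => P; rewrite oppr0.
(* Outside [s] the divisor [D] vanishes, so there is no pole. At a place of [s] it equals 1, and the
   factor [z] cancels the possible simple pole. *)
have [PB|PB] := boolP (P \in s); last first.
  move=> z0; have := rrD z0 P; rewrite /D /seq_divisor.
  by have /count_memPn -> := PB; rewrite oppr0.
have : vge P 0 (\sum_k iota (c k) * (b \o widen_ord ltNl) k); last by [].
apply: (@vge_le _ _ _ P (1 + - D P)).
  by rewrite /D /seq_divisor count_uniq_mem ?us// PB.
rewrite E; apply: vgeM; first by have := sz P PB => /= zP _; lia.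
apply: vge_sum => j; rewrite -[- _]add0r; apply: vgeM.
  by apply: vge_peval; have := sz P PB => /= zP _; exact: ltW.
by move=> bj0; apply: Db.
Qed.

Lemma divisor_principal z : divisor (fun P : place iota => P z).
Proof.
have fin := conj (finite_zeros z) (finite_zeros z^-1); move: fin.
rewrite -finite_setU; apply: sub_finite_set => P /=; rewrite placeV.
by case: (ltgtP (P z) 0) => //; [right; rewrite oppr_gt0|left].
Qed.

End Genus.

(** * The space of adeles modulo [A(D) + F] *)

Section Adeles.
Variables (K : finFieldType) (F : fieldType) (iota : {rmorphism K -> F}).
Local Notation Fm := (constant_module iota).
Implicit Types (P Q : place iota) (z : F) (D E : place iota -> int).
Hypothesis FF : function_field iota.
Hypothesis Kfull : full_constant_field iota.
Variable g : nat.
Hypothesis g_genus : is_genus iota g.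
Variable Q0 : place iota.

Local Notation rr D := (riemann_roch_space D : set Fm).

Definition adele : set (place iota -> Fm) :=
  [set a | exists2 E, divisor E & adele_space E a].

(* [A(D) + F], with [F] embedded diagonally. *)
Definition adele_sum D : set (place iota -> Fm) :=
  [set a | exists z, adele_space D (a - diag z)].

Definition amul (y : Fm) (a : place iota -> Fm) : place iota -> Fm :=
  fun P => (y : F) * a P.

Lemma amul_linear y : linear (amul y).
Proof.
move=> a u v; apply/funext => P.
by rewrite /amul !fctE !constant_scaleE mulrDr mulrCA.
Qed.

Lemma amul_linearl a : linear (amul^~ a).
Proof.
move=> c y z; apply/funext => P.
by rewrite /amul !fctE !constant_scaleE mulrDl mulrA.
Qed.

Lemma adele_sum_subspace D : subspace (adele_sum D).
Proof.
have sD := adele_space_subspace D; split.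
  by exists 0; rewrite subr0; case: sD.
move=> c u v [y uy] [z vz]; exists (c *: (y : Fm) + z).
have [_ /(_ c _ _ uy vz)] := sD; congr (adele_space D _).
by rewrite diag_linear scalerBr opprD addrACA.
Qed.

Lemma adele_sum_adele_space D : adele_space D `<=` adele_sum D.
Proof. by move=> a aD; exists 0; rewrite subr0. Qed.

Lemma adele_sum_diag D z : adele_sum D (diag z).
Proof. by exists z; rewrite subrr; case: (adele_space_subspace D). Qed.

(** The divisor of [y] has finite support, so multiplication by [y] merely shifts the bounding
    divisor. *)
Lemma adele_amul y a : adele a -> adele (amul y a).
Proof.
move=> [E dE aE]; exists (fun P => E P - P y).
  apply: divisor_sub2 dE (divisor_principal FF Kfull g_genus Q0 y).
  by move=> P -> ->; rewrite subr0.
move=> P; rewrite opprB addrC -[- E P + _]addrC.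
by apply: vgeM (aE P) => _.
Qed.

Lemma amul_adele_space D y a : rr D y -> adele_space (fun=> 0) a ->
  adele_space D (amul y a).
Proof.
rewrite riemann_roch_spaceE => yD a0 P; rewrite -[- _]addr0.
by apply: vgeM (yD P) _; have := a0 P; rewrite oppr0.
Qed.

Lemma amulK y a : y != 0 -> amul y (amul y^-1 a) = a.
Proof. by move=> y0; apply/funext => P; rewrite /amul mulVKf. Qed.

Lemma divisor_degree0 : divisor_degree (fun _ : place iota => 0) = 0.
Proof. by rewrite (@divisor_degreeE _ _ _ _ [::])// big_nil. Qed.

(** The [a j] lie in a common [A(E)] with [E >= 0]. Together with a diagonal basis of [L(E) / L(0)]
    they are independent in [A(E) / A(0)], so [ell E - 1 + k <= deg E], and the genus inequality for
    [E] concludes. *)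
Lemma adele_indep_leq_genus k (a : 'I_k -> place iota -> Fm) :
  (forall j, adele (a j)) -> indep_mod (adele_sum (fun=> 0)) a -> (k <= g)%N.
Proof.
move=> aa ia.
have /choice[E_ EP] : forall j, exists E, divisor E /\ adele_space E (a j).
  by move=> j; have [E] := aa j; exists E.
pose E := fun P => \big[Num.max/0]_j E_ j P.
have dE : divisor E by apply: divisor_bigmax (divisor0 _) _ => j; case: (EP j).
have E0 P : 0 <= E P by exact: bigmax_ge_id.
have aE j : adele_space E (a j).
  by apply: adele_space_le (EP j).2 => P; exact: le_bigmax.
have d0 := divisor0 iota.
have [l dl _] := has_dim_rr_mod FF Kfull d0 dE E0.
have eE := ell_add FF Kfull g_genus Q0 d0 dE E0 dl.
have [n [b [_ _ sb]] degE] := has_dim_adele FF Kfull d0 dE E0.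
have [c [Ec ic _]] := dl.
have : (l + k <= n)%N.
  apply: (indep_mod_leq_span (adele_space_subspace _) sb
    (c := fcat (fun i => diag (c i)) a)).
    apply: fcatP => // i; have := Ec i; by rewrite riemann_roch_spaceE.
  apply: (indep_mod_fcat (adele_sum_subspace (fun=> 0))) ia.
  - exact: adele_sum_adele_space.
  - by move=> i; exact: adele_sum_diag.
  - exact: indep_mod_diag.
have := divisor_degree_ell g_genus dE.
rewrite eE (ell0 FF Kfull g_genus Q0) degE divisor_degree0; lia.
Qed.

(** Let [D0] attain the genus and let [E] be the maximum of [D] and [D0]. The difference [deg - ell]
    does not decrease from [D0] to [E]. From [D] to [E] it does not increase either, because every
    adele of [A(E)] is a function modulo [A(D)]. *)
Lemma no_adele_obstruction D : divisor D -> adele `<=` adele_sum D ->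
  g%:Z <= divisor_degree D - (ell D)%:Z + 1.
Proof.
move=> dD aD; have [[D0 dD0 <-] _] := g_genus.
pose E := fun P => Num.max (D P) (D0 P).
have dE : divisor E := divisor_max dD dD0.
have DE P : D P <= E P by rewrite le_max lexx.
have D0E P : D0 P <= E P by rewrite le_max lexx orbT.
have [l0 dl0 le0] := has_dim_rr_mod FF Kfull dD0 dE D0E.
have e0 := ell_add FF Kfull g_genus Q0 dD0 dE D0E dl0.
have [l dl _] := has_dim_rr_mod FF Kfull dD dE DE.
have eD := ell_add FF Kfull g_genus Q0 dD dE DE dl.
have [n [e [Ee ie _]] degE] := has_dim_adele FF Kfull dD dE DE.
have /choice[z ze] : forall j, exists z : Fm, adele_space D (e j - diag z).
  by move=> j; apply: aD; exists E.
suff : (n <= l)%N by lia.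
have [b [_ _ sb]] := dl.
(* The functions [z j] that agree with the [e j] modulo [A(D)] lie in [L(E)] and inherit
   independence modulo [L(D)]. *)
apply: (indep_mod_leq_span (riemann_roch_subspace D) sb (c := z)).
  move=> j; rewrite riemann_roch_spaceE /=.
  have := subspaceB (adele_space_subspace E) (Ee j)
    (adele_space_le DE (ze j)).
  by rewrite opprB addrC subrK.
move=> a; rewrite riemann_roch_spaceE /= -diag_sum => az; apply: ie.
have := subspaceD (adele_space_subspace D)
  (subspace_sum a (adele_space_subspace D) ze) az.
rewrite -big_split /=.
by under eq_bigr do rewrite scalerBr subrK.
Qed.

(** Multiplication by [y] is bijective on adeles and maps [A(0) + F] into [A(D) + F]. *)
Lemma amul_span D y k (a : 'I_k -> place iota -> Fm) : rr D y -> y != 0 ->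
  span_mod (adele_sum (fun=> 0)) adele a ->
  span_mod (adele_sum D) adele (fun j => amul y (a j)).
Proof.
move=> yD y0 sa b /(adele_amul y^-1)/sa[c [z bz]].
exists c, ((y : F) * z).
rewrite -(linear_sumZ (@amul_linear y)).
suff -> : b - amul y (\sum_i c i *: a i) - diag ((y : F) * z) =
    amul y (amul y^-1 b - \sum_i c i *: a i - diag z).
  exact: amul_adele_space.
rewrite -{1}(amulK b y0); apply/funext => P.
by rewrite /amul !fctE !mulrBr.
Qed.

(* If [A <> A(D) + F], let [M] be a hyperplane of [A] containing [A(D) + F].
   As [A / (A(0) + F)] has dimension at most [g], some nonzero [y] in the span
   of the [x i] satisfies [y A <= M], which contradicts [y A = A]. *)
Lemma nonspecial D (x : 'I_g.+1 -> Fm) : divisor D ->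
  (forall i, rr D (x i)) -> indep_mod [set 0] x ->
  g%:Z <= divisor_degree D - (ell D)%:Z + 1.
Proof.
move=> dD xD ix; apply: no_adele_obstruction => //; apply: contrapT => nAD.
have [k kg [a [aa _ sa]]] := has_dim_bounded
  (adele_sum_subspace (fun=> 0)) adele_indep_leq_genus.
have nz (v : 'rV[K]_g.+1) : v != 0 -> \sum_i v 0 i *: x i != 0.
  apply: contra_neq => vx; apply/rowP => i.
  by rewrite mxE; apply: (ix (fun i => v 0 i)).
have xc (v : 'rV[K]_g.+1) : rr D (\sum_i v 0 i *: x i).
  by apply: subspace_sum => //; exact: riemann_roch_subspace.
(* [hyperplane_mod] asks for a finite spanning family modulo [A(D) + F]; multiplication by the
   nonzero element [x 0] of [L(D)] provides one. *)
have v1 : delta_mx 0 0 != 0 :> 'rV[K]_g.+1.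
  by apply/rV0Pn; exists 0; rewrite mxE !eqxx oner_eq0.
have [M [e [sM DM ae nMe Me]]] := hyperplane_mod (adele_sum_subspace D)
  (amul_span (xc _) (nz _ v1) sa) nAD.
(* [c i j] is the value at [x i * a j] of the functional with kernel [M]. This matrix has [g + 1]
   rows and at most [g] columns, so some [v] kills it. *)
have /choice[c cP] : forall i, exists c : 'I_k -> K,
    forall j, M (amul (x i) (a j) - c j *: e).
  move=> i; suff /choice[c ?] : forall j, exists c, M (amul (x i) (a j) - c *: e).
    by exists c.
  by move=> j; apply: Me; exact: adele_amul.
have [v v0 vc] := wide_matrix_kernel (\matrix_(i, j) c i j : 'M_(g.+1, k)) kg.
(* For [y] the combination of the [x i] given by [v], all [y * a j] lie in [M], yet they span the
   adeles modulo [A(D) + F], which forces [e] into [M]. *)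
have [d ed] := amul_span (xc v) (nz v v0) sa ae.
apply: nMe; rewrite -[e](subrK (\sum_j d j *: amul (\sum_i v 0 i *: x i) (a j))).
apply: subspaceD (DM _ ed) _ => //; apply: subspace_sum => // j.
have := subspace_sum (fun i => v 0 i) sM (fun i => cP i j).
rewrite (linear_sumZ (@amul_linearl (a j))).
under eq_bigr do rewrite scalerBr scalerA.
rewrite sumrB -scaler_suml.
have /rowP/(_ j) := vc; rewrite !mxE.
under eq_bigr do rewrite mxE.
by move=> ->; rewrite scale0r subr0.
Qed.

(** * Degree bounds for the two function families of a code *)

(** In a nontrivial relation exactly one term would have the least valuation at [P], and the
    remaining terms could not cancel it. *)
Lemma indep_distinct_valuations P n (f : 'I_n -> Fm) :
  (forall i, f i != 0) -> injective (fun i => P (f i)) -> indep_mod [set 0] f.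
Proof.
move=> f0 injf a af0 i; apply: contrapT => /eqP ai.
have [j aj jmin] := Order.TotalTheory.arg_minP
  (fun i => P (f i)) (P := fun i => a i != 0) ai.
have aj0 : iota (a j) != 0 by rewrite fmorph_eq0.
have Pj : P (iota (a j) * f j) = P (f j).
  by rewrite valuationM// place_const add0r.
have E : (iota (a j) * f j : F) =
    \sum_(l < n) (if l == j then 0 else - (iota (a l) * f l)).
  rewrite (bigD1 j)//= eqxx add0r; apply/eqP; rewrite -subr_eq0; apply/eqP.
  rewrite -[RHS]af0 [RHS](bigD1 j)//=; congr (_ + _).
  by rewrite -sumrN; apply: eq_bigr => l /negbTE->; rewrite opprK.
have : vge P (P (f j) + 1) (iota (a j) * f j).
  rewrite E; apply: vge_sum => l; case: eqP => [_|/eqP lj]; first exact: vge0.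
  rewrite -mulNr -rmorphN; have [->|al] := eqVneq (a l) 0.
    by rewrite oppr0 rmorph0 mul0r; exact: vge0.
  apply: vgeZ => _; have := jmin l al.
  have : P (f l) <> P (f j) by move=> /injf /eqP; rewrite (negbTE lj).
  lia.
rewrite /vge Pj mulf_neq0// => /(_ isT); lia.
Qed.

(** For nonzero [f i], the least divisor whose Riemann-Roch space contains them all. The maximum
    starts from a member of the family, not from 0, because coefficients may be negative. *)
Definition family_divisor n (f : 'I_n.+1 -> F) : place iota -> int :=
  fun P => \big[Num.max/- P (f ord0)]_i - P (f i).

Lemma divisor_family n (f : 'I_n.+1 -> F) : divisor (family_divisor f).
Proof.
have dN z : divisor (fun P => - P z).
  apply: divisor_sub (divisor_principal FF Kfull g_genus Q0 z).
  by move=> P ->; rewrite oppr0.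
exact: divisor_bigmax.
Qed.

(** The [n + 1] functions are independent in [L(D)], so [ell D >= n + 1]. The first [g + 1] of them
    make [D] nonspecial, whence [deg D >= g + ell D - 1 >= g + n]. *)
Lemma family_divisor_degree n (f : 'I_n.+1 -> F) Q : (g <= n)%N ->
  (forall i, f i != 0) -> injective (fun i => Q (f i)) ->
  g%:Z + n%:Z <= divisor_degree (family_divisor f).
Proof.
move=> gn f0 injf; have dD := divisor_family f.
have fD i : rr (family_divisor f) (f i).
  by move=> _ P; rewrite lerNl; exact: le_bigmax.
have indf := @indep_distinct_valuations Q _ f f0 injf.
have := @nonspecial _ (f \o widen_ord (gn : g < n.+1)%N) dD
  (fun i => fD _) (indep_mod_widen (le_mn := gn : (g < n.+1)%N) indf).
have [b [_ _ sb]] := has_dim_ell FF Kfull g_genus Q0 dD.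
have := indep_mod_leq_span (zero_subspace _) sb fD indf; lia.
Qed.

Lemma le_divisor_degree D E : divisor D -> divisor E -> (forall P, D P <= E P) ->
  divisor_degree D <= divisor_degree E.
Proof.
by move=> dD dE DE; have [n _ ->] := has_dim_adele FF Kfull dD dE DE; rewrite lerDl.
Qed.

Lemma divisor_code m (c : matdot_code iota m) : divisor (code_pole_divisor c).
Proof.
apply: divisor_bigmax (divisor0 _) _ => i.
apply: divisor_bigmax (divisor0 _) _ => j.
apply: divisor_sub
  (divisor_principal FF Kfull g_genus Q0 (code_f c i * code_g c j)) => P.
by rewrite /pole_divisor => ->; rewrite oppr0 maxxx.
Qed.

(** The pole divisor takes all pairs [(i, j)] into account, so the maxima over [i] and over [j] are
    reached independently. *)
Lemma family_divisor_code m (c : matdot_code iota m.+1) P :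
  family_divisor (code_f c) P + family_divisor (code_g c) P <=
  code_pole_divisor c P.
Proof.
have H i j : - P (code_f c i) - P (code_g c j) <= code_pole_divisor c P.
  rewrite -opprD -valuationM ?code_f_neq0 ?code_g_neq0//.
  apply: le_trans (le_bigmax _ _ i); apply: le_trans (le_bigmax _ _ j).
  by rewrite le_max lexx orbT.
rewrite -lerBrDr; apply: bigmax_le => [|i _].
  rewrite lerBrDr addrC -lerBrDr; apply: bigmax_le => [|j _];
    by rewrite lerBrDr addrC.
rewrite lerBrDr addrC -lerBrDr; apply: bigmax_le => [|j _];
  by rewrite lerBrDr addrC.
Qed.

End Adeles.

Theorem proposition4p1
  (K : finFieldType) (F : fieldType) (iota : {rmorphism K -> F})
  (F_function_field : function_field iota)
  (K_full : full_constant_field iota)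
  (g : nat) (g_genus : is_genus iota g)
  (m : nat) (m_ge1 : (1 <= m)%N)
  (Ropt : int) (Ropt_optimal : is_optimal_threshold iota m Ropt)
  (m_ge : (g + 1 <= m)%N) :
  (2 * g%:Z + 2 * m%:Z - 1 <= Ropt)%R.
Proof.
(* From here on the code has [m + 1] functions on each side. Each family divisor has degree at least
   [g + m], and the threshold is at least [2 * (g + m) + 1]. *)
case: Ropt_optimal => -[c <-] _; case: m m_ge1 m_ge c => // m _ gm c.
have [Q [d Qd]] := code_valuation c.
have QE i j : Q (code_f c i * code_g c j) = Q (code_f c i) + Q (code_g c j).
  by rewrite valuationM ?code_f_neq0 ?code_g_neq0.
have QEd i : Q (code_f c i) + Q (code_g c i) = d by rewrite -QE; apply/Qd.
have gm' : (g <= m)%N by rewrite -ltnS -addn1.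
(* If [f_i] and [f_j] had the same valuation at [Q], then [f_i g_j] would have the valuation [d] of
   [f_j g_j], forcing [i = j]. *)
have injf : injective (fun i => Q (code_f c i)).
  by move=> i j ij; apply/Qd; rewrite QE /= ij.
have injg : injective (fun i => Q (code_g c i)).
  by move=> i j ij; apply/Qd; rewrite QE -ij.
(* The place [Q] of the code also serves as the base place [Q0]. *)
have degf := family_divisor_degree F_function_field K_full g_genus Q gm'
  (code_f_neq0 c) injf.
have degg := family_divisor_degree F_function_field K_full g_genus Q gm'
  (code_g_neq0 c) injg.
have dF n (f : 'I_n.+1 -> F) : divisor (@family_divisor _ _ iota n f) :=
  divisor_family F_function_field K_full g_genus Q f.
have := le_divisor_degree F_function_field K_full
  (divisorD (dF _ (code_f c)) (dF _ (code_g c)))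
  (divisor_code F_function_field K_full g_genus Q c) (family_divisor_code c).
rewrite divisor_degreeD// /recovery_threshold; lia.
Qed.
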